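(* Let $n \geq 1$. For full-rank lattices $L, L' \subset \mathbb{R}^n$ define $$\mathrm{offset}(L,L') = \min\{ r \geq 0 : R(V(L)) \subset N(V(L');r) \text{ for some } R \in SO(n)\},$$ $$d_H(L,L') = \max\{ \mathrm{offset}(L,L'), \mathrm{offset}(L',L)\}.$$ Then $d_H$ is independent of the representation of the lattices (it depends only on the lattices $L, L'$ as point sets, not on chosen bases or unit cells), and it satisfies: (a) $d_H(L,L') \geq 0$, and $d_H(L,L') = 0$ if and only if $L$ and $L'$ are equivalent, i.e. $R(L) = L'$ for some $R \in SO(n)$; (b) $d_H(L,L') = d_H(L',L)$ for all $L, L'$; (c) $d_H(L,L') + d_H(L',L'') \geq d_H(L,L'')$ for all $L, L', L''$; (d) $d_H$ changes continuously under perturbations of the lattices: if $L(B)$ denotes the lattice generated by the columns of an invertible real $n\times n$ matrix $B$, then $(B,B') \mapsto d_H(L(B),L(B'))$ is continuous on $GL_n(\mathbb{R}) \times GL_n(\mathbb{R})$.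
   Context: A (full-rank) lattice in $\mathbb{R}^n$ is the set $L = \{ x_1 u_1 + \dots + x_n u_n : x_i \in \mathbb{Z}\}$ for a basis $u_1,\dots,u_n$ of $\mathbb{R}^n$; in particular $0 \in L$. The Voronoi cell of $L$ is $V(L) = \{ p \in \mathbb{R}^n : d(p,0) \leq d(p,q) \text{ for all } q \in L \setminus \{0\}\}$, where $d$ is the Euclidean distance; it is a convex polytope centrally symmetric about $0$. For $C \subset \mathbb{R}^n$ and $r\ge 0$, $N(C;r) = \{ p \in \mathbb{R}^n : d(p,q) \leq r \text{ for some } q \in C\}$ is the $r$-offset of $C$. $SO(n)$ is the group of real $n \times n$ orthogonal matrices of determinant $1$ (rotations about the origin). Two lattices are called equivalent if one is obtained from the other by an orientation-preserving rigid motion of $\mathbb{R}^n$; for lattices (which contain $0$) this is the same as $R(L)=L'$ for some $R\in SO(n)$. *)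

(* Defs.v *)
From HB Require Import structures.
From mathcomp Require Import all_boot all_order all_algebra.
From mathcomp Require Import all_classical all_reals all_analysis.
Set Implicit Arguments. Unset Strict Implicit. Unset Printing Implicit Defensive.
Import Order.TTheory GRing.Theory Num.Theory.
Import numFieldNormedType.Exports.
Local Open Scope classical_set_scope.
Local Open Scope ring_scope.

Section Defs.
Variables (R : realType) (n : nat).

Definition edist (p q : 'cV[R]_n) : R :=
  Num.sqrt (\sum_(i < n) (p i 0 - q i 0) ^+ 2).

Definition lattice_of (B : 'M[R]_n) : set 'cV[R]_n :=
  [set x | exists z : 'cV[int]_n, x = B *m map_mx (fun k : int => k%:~R) z].

Definition is_lattice (L : set 'cV[R]_n) : Prop :=
  exists B : 'M[R]_n, B \in unitmx /\ L = lattice_of B.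

Definition voronoi (L : set 'cV[R]_n) : set 'cV[R]_n :=
  [set p | forall q, L q -> q != 0 -> edist p 0 <= edist p q].

Definition offset_set (C : set 'cV[R]_n) (r : R) : set 'cV[R]_n :=
  [set p | exists2 q, C q & edist p q <= r].

Definition is_SO (M : 'M[R]_n) : Prop := M^T *m M = 1%:M /\ \det M = 1.

Definition rot_image (M : 'M[R]_n) (C : set 'cV[R]_n) : set 'cV[R]_n :=
  (fun p => M *m p) @` C.

Definition offset_radii (L L' : set 'cV[R]_n) : set R :=
  [set r | 0 <= r /\ exists M, is_SO M /\
     rot_image M (voronoi L) `<=` offset_set (voronoi L') r].

(* offset(L,L'): the paper's min, taken as the infimum (its attainment is
   part of the theorem). *)
Definition lat_offset (L L' : set 'cV[R]_n) : R := inf (offset_radii L L').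

Definition dH (L L' : set 'cV[R]_n) : R :=
  Num.max (lat_offset L L') (lat_offset L' L).

Definition lat_equiv (L L' : set 'cV[R]_n) : Prop :=
  exists M, is_SO M /\ rot_image M L = L'.

End Defs.

(* Main.v *)
Require Import Defs.
From HB Require Import structures.
From mathcomp Require Import all_boot all_order all_algebra.
From mathcomp Require Import all_classical all_reals all_analysis.
From mathcomp Require Import perm ring lra zify.
Import Order.TTheory GRing.Theory Num.Theory.
Import numFieldNormedType.Exports.
Local Open Scope classical_set_scope.
Local Open Scope ring_scope.

(* Voronoi cells and SO(n) are compact, so the offset is attained, and composing
   rotations gives the triangle inequality. If both offsets vanish, rotations M
   and N map V(L) into V(L') and V(L') into V(L); then N M is an isometry of the
   compact set V(L) into itself, hence onto, so that V(N L') = V(L). A Voronoi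
   cell determines its lattice: in an irredundant description of V(L) by finitely
   many vectors of L, each of them can be read off its facet, so it lies in every
   lattice with the same cell, and these vectors generate L because subtracting
   one that cuts off x from V(L) makes x shorter. For continuity, if L = T L0
   with T close to 1, then each cell shrunk by a factor close to 1 lies in the
   other one. *)

Set Implicit Arguments.
Unset Strict Implicit.
Unset Printing Implicit Defensive.

(* MathComp-Analysis also has an edist, with extended real values. *)
Local Notation edist := Defs.edist.

(** * Euclidean norm *)

Section Dot.
Variables (R : realType) (n : nat).
Implicit Types (u v w : 'cV[R]_n) (M : 'M[R]_n).

Definition dot u v : R := \sum_i u i 0 * v i 0.
Definition enorm u : R := Num.sqrt (dot u u).

Lemma dotE u v : dot u v = (u^T *m v) 0 0.
Proof. by rewrite mxE; apply: eq_bigr => i _; rewrite mxE. Qed.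

Lemma dotC u v : dot u v = dot v u.
Proof. by apply: eq_bigr => i _; rewrite mulrC. Qed.

Lemma dotDl u v w : dot (u + v) w = dot u w + dot v w.
Proof.
by rewrite /dot -big_split; apply: eq_bigr => i _; rewrite mxE mulrDl.
Qed.

Lemma dotZl a u v : dot (a *: u) v = a * dot u v.
Proof. by rewrite /dot mulr_sumr; apply: eq_bigr => i _; rewrite mxE mulrA. Qed.

Lemma dotDr u v w : dot w (u + v) = dot w u + dot w v.
Proof. by rewrite dotC dotDl !(dotC w). Qed.

Lemma dotZr a u v : dot u (a *: v) = a * dot u v.
Proof. by rewrite dotC dotZl dotC. Qed.

Lemma dotNl u v : dot (- u) v = - dot u v.
Proof. by rewrite -scaleN1r dotZl mulN1r. Qed.

Lemma dotNr u v : dot u (- v) = - dot u v.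
Proof. by rewrite dotC dotNl dotC. Qed.

Definition dotL := (dotDl, dotDr, dotNl, dotNr, dotZl, dotZr).

Lemma dot_ge0 u : 0 <= dot u u.
Proof. by apply: sumr_ge0 => i _; rewrite -expr2 sqr_ge0. Qed.

Lemma dot_eq0 u : dot u u = 0 -> u = 0.
Proof.
move=> /eqP; rewrite psumr_eq0 => [/allP u0|i _]; last by rewrite -expr2 sqr_ge0.
apply/colP => i; rewrite mxE; apply/eqP.
by have := u0 i (mem_index_enum i); rewrite /= -expr2 sqrf_eq0.
Qed.

Lemma dot0l u : dot 0 u = 0.
Proof. by rewrite -(scale0r 0) dotZl mul0r. Qed.

Lemma enorm_ge0 u : 0 <= enorm u. Proof. exact: sqrtr_ge0. Qed.

Lemma enorm_sqr u : enorm u ^+ 2 = dot u u.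
Proof. by rewrite sqr_sqrtr // dot_ge0. Qed.

Lemma enorm0 : enorm 0 = 0.
Proof. by rewrite /enorm dot0l sqrtr0. Qed.

Lemma enorm_eq0 (u : 'cV[R]_n) : enorm u = 0 -> u = 0.
Proof. by move=> u0; apply: dot_eq0; rewrite -enorm_sqr u0 expr0n. Qed.

Lemma enormZ a u : enorm (a *: u) = `|a| * enorm u.
Proof.
by rewrite /enorm dotZl dotZr mulrA -expr2 sqrtrM ?sqr_ge0 // sqrtr_sqr.
Qed.

Lemma enormN u : enorm (- u) = enorm u.
Proof. by rewrite -scaleN1r enormZ normrN1 mul1r. Qed.

Lemma edistE u v : edist u v = enorm (u - v).
Proof.
by congr Num.sqrt; apply: eq_bigr => i _; rewrite !mxE expr2.
Qed.

(** The squared norm of [dot v v *: u - dot u v *: v] equals [dot v v] times the difference of the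
    two sides. *)
Lemma cauchy_schwarz_sqr u v : dot u v ^+ 2 <= dot u u * dot v v.
Proof.
have [v0|vN0] := eqVneq (dot v v) 0.
  by rewrite (dot_eq0 v0) dotC dot0l expr0n dot0l mulr0.
have vp : 0 < dot v v by rewrite lt_def vN0 dot_ge0.
rewrite -subr_ge0 -(pmulr_rge0 _ vp).
have := dot_ge0 (dot v v *: u - dot u v *: v); rewrite !dotL (dotC v u).
by congr (_ <= _); ring.
Qed.

Lemma norm_dot_le u v : `|dot u v| <= enorm u * enorm v.
Proof.
by rewrite -sqrtrM ?dot_ge0 // -sqrtr_sqr ler_wsqrtr // cauchy_schwarz_sqr.
Qed.

Lemma cauchy_schwarz u v : dot u v <= enorm u * enorm v.
Proof. exact: le_trans (ler_norm _) (norm_dot_le u v). Qed.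

Lemma enormD u v : enorm (u + v) <= enorm u + enorm v.
Proof.
rewrite -(@ler_pXn2r _ 2) ?nnegrE ?addr_ge0 ?enorm_ge0 // enorm_sqr.
rewrite sqrrD !enorm_sqr !dotL (dotC v u).
have := cauchy_schwarz u v; lra.
Qed.

Lemma edist_le_trans u v w : edist u w <= edist u v + edist v w.
Proof. by rewrite !edistE -(subrKA v u) enormD. Qed.

Lemma edistC u v : edist u v = edist v u.
Proof. by rewrite !edistE -enormN opprB. Qed.

Lemma dot_orthogonal M u v : M^T *m M = 1%:M -> dot (M *m u) (M *m v) = dot u v.
Proof. by move=> MO; rewrite !dotE trmx_mul -mulmxA (mulmxA M^T) MO mul1mx. Qed.

Lemma edist_orthogonal M u v :
  M^T *m M = 1%:M -> edist (M *m u) (M *m v) = edist u v.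
Proof. by move=> MO; rewrite !edistE -mulmxBr /enorm dot_orthogonal. Qed.

(** * Comparison of the Euclidean norm with the entrywise maximum norm *)

Lemma entry_le_enorm u i : `|u i 0| <= enorm u.
Proof.
rewrite -sqrtr_sqr ler_wsqrtr // /dot (bigD1 i) //= -expr2 lerDl.
by apply: sumr_ge0 => j _; rewrite -expr2 sqr_ge0.
Qed.

Lemma entry_le_norm p q (A : 'M[R]_(p, q)) i j : `|A i j| <= `|A|.
Proof.
by rewrite [leRHS]/Num.norm /= mx_normrE; apply/bigmax_geP; right; exists (i, j).
Qed.

Lemma norm_le_entries p q (A : 'M[R]_(p, q)) c :
  0 <= c -> (forall i j, `|A i j| <= c) -> `|A| <= c.
Proof.
move=> c0 Ac; rewrite [leLHS]/Num.norm /= mx_normrE; apply/bigmax_leP.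
by split => // -[i j] _; exact: Ac.
Qed.

Lemma norm_le_enorm u : `|u| <= enorm u.
Proof.
by apply: norm_le_entries => [|i j]; rewrite ?enorm_ge0 // ord1 entry_le_enorm.
Qed.

Lemma enorm_le_entries u c : 0 <= c ->
  (forall i, `|u i 0| <= c) -> enorm u <= n%:R * c.
Proof.
move=> c0 uc; have nc : 0 <= n%:R * c :> R by rewrite mulr_ge0.
rewrite -(ger0_norm nc) -sqrtr_sqr ler_wsqrtr //.
apply: (@le_trans _ _ (\sum_(i < n) c ^+ 2)).
  apply: ler_sum => i _; rewrite -expr2 -real_normK ?num_real //.
  by rewrite ler_pXn2r ?nnegrE.
rewrite sumr_const card_ord exprMn -(mulr_natl (c ^+ 2)) ler_wpM2r ?sqr_ge0 //.
by rewrite -natrX ler_nat; case: n => // k; rewrite expnS expn1 leq_pmull.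
Qed.

Lemma enorm_le_norm u : enorm u <= n%:R * `|u|.
Proof. by apply: enorm_le_entries => // i; exact: entry_le_norm. Qed.

(** One factor [n] comes from summing along a row, the other from passing from entries to the
    Euclidean norm. Any explicit constant suffices for the later estimates. *)
Lemma enorm_mulmx M u : enorm (M *m u) <= n%:R * `|M| * (n%:R * enorm u).
Proof.
rewrite -mulrA; apply: enorm_le_entries => [|i].
  by rewrite !mulr_ge0 ?enorm_ge0.
rewrite mxE; apply: le_trans (ler_norm_sum _ _ _) _.
have -> : `|M| * (n%:R * enorm u) = \sum_(j < n) `|M| * enorm u.
  by rewrite sumr_const card_ord mulrCA mulr_natl.
apply: ler_sum => j _; rewrite normrM ler_pM //.
  exact: entry_le_norm.
exact: entry_le_enorm.
Qed.

End Dot.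

(** Bounds the cost of replacing one rotation by a nearby one, for passing to the limit in a
    sequence of rotations. *)
Lemma edist_rot (R : realType) n (u v : 'cV[R]_n) M N :
  edist (M *m u) v <= edist (N *m u) v + n%:R * `|M - N| * (n%:R * enorm u).
Proof.
rewrite addrC; apply: le_trans (edist_le_trans _ (N *m u) _) _.
by rewrite lerD2r edistE -mulmxBl enorm_mulmx.
Qed.

(** Heine-Borel for row vectors, transported by [mxvec]. A cluster point approached at arbitrarily
    late indices takes the place of a convergent subsequence. *)
Lemma bounded_seq_cluster (R : realType) m n (u : nat -> 'M[R]_(m, n)) c :
  (forall k, `|u k| <= c) ->
  exists A, forall e N, 0 < e -> exists2 k, (N <= k)%N & `|u k - A| < e.
Proof.
move=> uc; have c0 : 0 <= c by apply: le_trans (uc 0%N).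
pose v k := mxvec (u k).
have : compact [set x : 'rV[R]_(m * n) | `|x| <= c].
  apply: bounded_closed_compact.
    exists c; split; first exact: num_real.
    by move=> y cy x /= xc; apply: le_trans xc (ltW cy).
  apply: (@preimage_closed _ _ (fun x : 'rV[R]_(m * n) => `|x|)
           [set r | r <= c]).
    by move=> x _; exact: norm_continuous.
  exact: closed_le.
move=> /(_ (v @ \oo) _) [|x [_ xcl]].
  exists 0%N => // k _ /=; apply: norm_le_entries => // i j.
  case/mxvec_indexP: j => a b; rewrite ord1 mxvecE.
  by apply: le_trans (uc k); exact: entry_le_norm.
exists (vec_mx x) => e N e0.
(* Comparing entries yields only a weak inequality, hence the smaller radius. *)
have e20 : 0 < e / 2 by lra.
have vN : (v @ \oo) [set v k | k in [set k | (N <= k)%N]].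
  by exists N => // k /= Nk; exists k.
have [_ [[k Nk <-]]] := xcl _ _ vN (nbhsx_ballx x _ e20).
rewrite -ball_normE /= => xv; exists k => //.
apply: le_lt_trans (_ : e / 2 < e); last by lra.
apply: norm_le_entries => [|i j]; first by lra.
apply: le_trans (ltW xv).
have -> : (u k - vec_mx x) i j = - ((x - v k) 0 (mxvec_index i j)).
  by rewrite !mxE -mxvecE opprB.
by rewrite normrN entry_le_norm.
Qed.

(** * Compactness of SO(n) *)

Section Rotations.
Variables (R : realType) (n : nat).
Implicit Types (M N : 'M[R]_n).

Lemma SO1 : is_SO (1%:M : 'M[R]_n).
Proof. by split; rewrite ?det1 // trmx1 mulmx1. Qed.

Lemma SO_mul M N : is_SO M -> is_SO N -> is_SO (M *m N).
Proof.
move=> [MO Md] [NO Nd]; split; last by rewrite det_mulmx Md Nd mulr1.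
by rewrite trmx_mul -mulmxA (mulmxA M^T) MO mul1mx.
Qed.

Lemma SO_tr M : is_SO M -> is_SO M^T.
Proof. by move=> [MO Md]; split; rewrite ?det_tr // trmxK mulmx1C. Qed.

Lemma SO_norm_le1 M : is_SO M -> `|M| <= 1.
Proof.
move=> [MO _]; apply: norm_le_entries => // i j.
have /matrixP/(_ j j) := MO; rewrite !mxE eqxx mulr1n => Mj.
rewrite -(@ler_pXn2r _ 2) ?nnegrE // expr1n real_normK ?num_real // -[leRHS]Mj.
rewrite (bigD1 i) //= mxE -expr2 lerDl.
by apply: sumr_ge0 => k _; rewrite mxE -expr2 sqr_ge0.
Qed.

Lemma sum_continuous (T : topologicalType) (I : Type) (r : seq I)
    (F : I -> T -> R) :
  (forall i, continuous (F i)) -> continuous (fun x => \sum_(i <- r) F i x).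
Proof.
move=> Fc; apply: (@continuous_big R I +%R 0 predT _ T r F (fun i _ => Fc i)).
exact: (@add_continuous R^o).
Qed.

Lemma det_continuous : continuous (fun M : 'M[R]_n => \det M).
Proof.
apply: sum_continuous => s M.
apply: (@continuousM R _ (fun=> (-1) ^+ s) (fun N => \prod_i N i ((s : 'S_n) i))).
  exact: cst_continuous.
apply: (@continuous_big R _ *%R 1) => [|i _]; first exact: mul_continuous.
exact: coord_continuous.
Qed.

Lemma tr_mul_continuous i j : continuous (fun M : 'M[R]_n => (M^T *m M) i j).
Proof.
have -> : (fun M : 'M[R]_n => (M^T *m M) i j) = (fun M => \sum_k M k i * M k j).
  by apply/funext => M; rewrite mxE; apply: eq_bigr => k _; rewrite mxE.
apply: sum_continuous => k M.
by apply: (@continuousM R _ (fun N => N k i) (fun N => N k j));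
  exact: coord_continuous.
Qed.

(** The conditions are equations between continuous functions: the entries of [M^T *m M] and the
    determinant. *)
Lemma closed_SO : closed [set M : 'M[R]_n | is_SO M].
Proof.
have -> : [set M : 'M[R]_n | is_SO M] =
    (\bigcap_(ij : 'I_n * 'I_n)
       ((fun M : 'M[R]_n => (M^T *m M) ij.1 ij.2) @^-1`
          [set x | x = 1%:M ij.1 ij.2]))
    `&` ((fun M : 'M[R]_n => \det M) @^-1` [set x | x = 1]).
  apply/seteqP; split => M /=.
    by move=> [MO Md]; split => // -[i j] _ /=; rewrite MO.
  by move=> [MO Md]; split => //; apply/matrixP => i j; exact: (MO (i, j)).
apply: closedI.
  apply: closed_bigI => ij _; apply: preimage_closed; last exact: closed_eq.
  by move=> M _; exact: tr_mul_continuous.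
apply: preimage_closed; last exact: closed_eq.
by move=> M _; exact: det_continuous.
Qed.

Lemma SO_seq_cluster (u : nat -> 'M[R]_n) : (forall k, is_SO (u k)) ->
  exists2 A, is_SO A &
    forall (e : R) m, 0 < e -> exists2 k, (m <= k)%N & `|u k - A| < e.
Proof.
move=> uSO; have [A uA] := bounded_seq_cluster (fun k => SO_norm_le1 (uSO k)).
exists A => //; have : closure [set M : 'M[R]_n | is_SO M] A.
  move=> B /nbhs_ballP[e e0 eB]; have [k _ ukA] := uA e 0%N e0.
  by exists (u k); split; [exact: uSO | apply: eB; rewrite -ball_normE /= distrC].
by rewrite -((closure_id _).1 closed_SO).
Qed.

End Rotations.

(** * Lattices *)

Section Lattices.
Variables (R : realType) (n : nat).
Implicit Types (B M T : 'M[R]_n) (L : set 'cV[R]_n) (p q v x : 'cV[R]_n).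

Lemma lattice0 L : is_lattice L -> L 0.
Proof.
move=> [B [_ ->]]; exists 0; rewrite -[LHS](mulmx0 _ B); congr (_ *m _).
by apply/matrixP => i j; rewrite !mxE.
Qed.

Lemma latticeB L p q : is_lattice L -> L p -> L q -> L (p - q).
Proof.
move=> [B [_ ->]] [y ->] [z ->]; exists (y - z); rewrite -mulmxBr.
by congr (_ *m _); apply/matrixP => i j; rewrite !mxE intrB.
Qed.

Lemma latticeD L p q : is_lattice L -> L p -> L q -> L (p + q).
Proof.
move=> Ll Lp Lq; rewrite -(opprK q) -[- q]sub0r.
by do !apply: latticeB => //; exact: lattice0.
Qed.

Lemma lattice_mul L M : is_lattice L -> M \in unitmx ->
  is_lattice (rot_image M L).
Proof.
move=> [B [BU ->]] MU; exists (M *m B); split; first by rewrite unitmx_mul MU.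
apply/seteqP; split => [_ [_ [z ->] <-]|_ [z ->]].
  by exists z; rewrite mulmxA.
by exists (B *m map_mx intr z); [exists z | rewrite mulmxA].
Qed.

(** Rounding down the coordinates of [p] in the basis [B] leaves an error [B *m y] with the entries
    of [y] in [0, 1). *)
Lemma lattice_covering L : is_lattice L ->
  exists2 rho, 0 <= rho & forall p, exists2 q, L q & enorm (p - q) <= rho.
Proof.
move=> [B [BU ->]]; exists (n%:R * `|B| * (n%:R * (n%:R * 1))) => [|p].
  by rewrite !mulr_ge0.
pose x := invmx B *m p.
exists (B *m map_mx (fun k : int => k%:~R) (map_mx (@Num.floor R) x)).
  by eexists.
rewrite -{1}(mulKVmx BU p) -mulmxBr; apply: le_trans (enorm_mulmx _ _) _.
rewrite ler_wpM2l ?mulr_ge0 // ler_wpM2l //; apply: enorm_le_entries => // i.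
rewrite !mxE -/x; have /andP[] := floor_itv ((invmx B *m p) i 0).
rewrite intrD mxE => fl fu; rewrite ger0_norm; lra.
Qed.

(** A nonzero [q] has an integer coordinate of absolute value at least 1, which bounds [enorm q]
    below; multiplying by [enorm q] gives a form that also covers [q = 0]. *)
Lemma lattice_separation L : is_lattice L ->
  exists2 c, 0 <= c & forall q, L q -> enorm q <= c * dot q q.
Proof.
move=> [B [BU ->]]; exists (n%:R * `|invmx B| * n%:R) => [|_ [z ->]].
  by rewrite !mulr_ge0.
set zr := map_mx _ z; set q := B *m zr.
have [z0|/eqP zN0] := pselect (z = 0).
  suff -> : q = 0 by rewrite enorm0 dot0l mulr0.
  rewrite -(mulmx0 _ B) /q; congr (_ *m _).
  by apply/matrixP => i j; rewrite !mxE z0 mxE.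
rewrite -enorm_sqr expr2 mulrA ler_peMl ?enorm_ge0 // -!mulrA mulrA.
apply: le_trans (enorm_mulmx _ _); rewrite mulKmx //.
have /existsP[i zi] : [exists i, z i 0 != 0].
  apply: contraNT zN0; rewrite negb_exists => /forallP z0.
  by apply/eqP/colP => i; rewrite mxE; apply/eqP; have := z0 i; rewrite negbK.
apply: le_trans (entry_le_enorm _ i); rewrite mxE -intr_norm.
by rewrite (ler_int R 1) -gtz0_ge1 normr_gt0.
Qed.

Lemma lattice_finite L C : is_lattice L ->
  exists s : seq 'cV[R]_n, forall q, L q -> enorm q <= C -> q \in s.
Proof.
move=> [B [BU ->]]; pose K := Num.bound (n%:R * `|invmx B| * (n%:R * C)).
(* Integer vectors with entries in [-K, K], encoded by ordinals up to 2K shifted down by [K]. *)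
pose f (w : 'cV['I_(K + K).+1]_n) : 'cV[R]_n :=
  B *m map_mx (fun k : int => k%:~R)
    (map_mx (fun k : 'I_(K + K).+1 => k%:Z - K%:Z) w).
exists (map f (enum {: 'cV['I_(K + K).+1]_n})) => _ [z ->] zC.
have zK i : `|z i 0| <= K%:Z.
  rewrite -(ler_int R) intr_norm.
  have -> : (z i 0)%:~R = map_mx (fun k : int => k%:~R : R) z i 0 by rewrite mxE.
  apply: le_trans (entry_le_enorm _ i) _.
  rewrite -(mulKmx BU (map_mx _ z)); apply: le_trans (enorm_mulmx _ _) _.
  apply: le_trans (ltW (archi_boundP _)); last first.
    by rewrite !mulr_ge0 // (le_trans (enorm_ge0 _) zC).
  by rewrite ler_wpM2l ?mulr_ge0 // ler_wpM2l.
apply/mapP; exists (map_mx (fun k : int => inord (absz (k + K%:Z))) z).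
  by rewrite mem_enum.
rewrite /f; congr (_ *m map_mx _ _); apply/colP => i; rewrite !mxE.
have /andP[zl zu] : - K%:Z <= z i 0 <= K%:Z by rewrite -ler_norml.
rewrite inordK; first by rewrite gez0_abs; lia.
by rewrite ltnS -lez_nat gez0_abs; lia.
Qed.

End Lattices.

(** * Voronoi cells and offsets *)

Section Voronoi.
Variables (R : realType) (n : nat).
Implicit Types (M N : 'M[R]_n) (L : set 'cV[R]_n) (p q v x : 'cV[R]_n).

(** Squaring and expanding turns each distance comparison into a half-space; the one for [q = 0] is
    trivial. *)
Lemma voronoiP L p : voronoi L p <-> forall q, L q -> 2 * dot p q <= dot q q.
Proof.
have pq q : (edist p 0 <= edist p q) = (2 * dot p q <= dot q q).
  rewrite !edistE subr0 ler_sqrt ?dot_ge0 // !dotL (dotC q p).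
  by apply/idP/idP; lra.
split=> [pV q Lq|pV q Lq _]; last by rewrite pq pV.
have [->|qN0] := eqVneq q 0; first by rewrite dotC !dot0l mulr0.
by rewrite -pq pV.
Qed.

Lemma voronoi0 L : voronoi L 0.
Proof. by apply/voronoiP => q _; rewrite dot0l mulr0 dot_ge0. Qed.

(** A point of the cell is at least as close to 0 as to the lattice point within [rho] of it. *)
Lemma voronoi_le_covering L rho p :
  (forall p, exists2 q, L q & enorm (p - q) <= rho) ->
  voronoi L p -> enorm p <= rho.
Proof.
move=> cov pV; have [q Lq] := cov p; apply: le_trans.
have [->|qN0] := eqVneq q 0; first by rewrite subr0.
by have := pV q Lq qN0; rewrite !edistE subr0.
Qed.

Lemma voronoi_bounded L : is_lattice L ->
  exists2 rho, 0 <= rho & forall p, voronoi L p -> enorm p <= rho.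
Proof.
move=> /lattice_covering[rho rho0 cov]; exists rho => // p.
exact: voronoi_le_covering.
Qed.

Lemma voronoi_closed L p :
  (forall e, 0 < e -> exists2 q, voronoi L q & edist q p <= e) -> voronoi L p.
Proof.
move=> pcl; apply/voronoiP => v Lv; apply/ler_addgt0Pr => e e0.
have v0 := enorm_ge0 v; have d0 : 0 < 2 * (enorm v + 1) by lra.
have [q /voronoiP/(_ v Lv) qv] := pcl _ (divr_gt0 e0 d0).
rewrite ler_pdivlMr // edistC edistE => pq.
have := cauchy_schwarz (p - q) v; have := enorm_ge0 (p - q).
rewrite dotDl dotNl; nra.
Qed.

Lemma voronoi_rot M L : M^T *m M = 1%:M ->
  voronoi (rot_image M L) = rot_image M (voronoi L).
Proof.
move=> MO; have MO' := mulmx1C MO.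
apply/seteqP; split => [p /voronoiP pV|_ [p /voronoiP pV <-]].
  exists (M^T *m p); last by rewrite mulmxA MO' mul1mx.
  apply/voronoiP => q Lq.
  rewrite -(dot_orthogonal (M^T *m p) q MO) -(dot_orthogonal q q MO).
  by rewrite mulmxA MO' mul1mx; apply: pV; exists q.
by apply/voronoiP => _ [q Lq <-]; rewrite !dot_orthogonal // pV.
Qed.

Lemma voronoi_seq_cluster L (u : nat -> 'cV[R]_n) : is_lattice L ->
  (forall k, voronoi L (u k)) -> exists2 q, voronoi L q &
    forall (e : R) m, 0 < e -> exists2 k, (m <= k)%N & edist (u k) q < e.
Proof.
move=> Ll uV; have [rho _ Vrho] := voronoi_bounded Ll.
have [k|q uq] := @bounded_seq_cluster R n 1 u rho.
  exact: le_trans (norm_le_enorm _) (Vrho _ (uV k)).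
have {}uq (e : R) m : 0 < e -> exists2 k, (m <= k)%N & edist (u k) q < e.
  move=> e0; have n0 : 0 < n%:R + 1 :> R by rewrite ltr_wpDl.
  have [k mk] := uq _ m (divr_gt0 e0 n0).
  rewrite ltr_pdivlMr // => ukq; exists k => //; rewrite edistE.
  apply: le_lt_trans (enorm_le_norm _) _.
  by have := normr_ge0 (u k - q); move: ukq; rewrite mulrDr mulr1 mulrC; lra.
exists q => //; apply: voronoi_closed => e e0.
by have [k _ /ltW] := uq e 0%N e0; exists (u k).
Qed.

Lemma offset_voronoi_closed L p r : is_lattice L ->
  (forall e, 0 < e -> offset_set (voronoi L) (r + e) p) ->
  offset_set (voronoi L) r p.
Proof.
move=> Ll pr.
have /choice[u uP] k : exists q, voronoi L q /\ edist p q <= r + k.+1%:R^-1.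
  by have [|q] := pr k.+1%:R^-1; [rewrite invr_gt0 | exists q].
have [|q qV uq] := @voronoi_seq_cluster L u Ll; first by move=> k; have [] := uP k.
exists q => //; apply/ler_addgt0Pr => e e0; have e20 : 0 < e / 2 by lra.
have [m _ me] := near_infty_natSinv_lt (PosNum e20).
have [k mk ukq] := uq _ m e20; apply: le_trans (edist_le_trans _ (u k) _) _.
have [_ puk] := uP k; have /= := me k mk.
move: puk ukq; set d := _^-1; lra.
Qed.

(** * Offset radii and attainment of the minimum *)

Lemma offset_radiiP L L' r : offset_radii L L' r <->
  0 <= r /\ exists2 M, is_SO M &
    forall p, voronoi L p -> offset_set (voronoi L') r (M *m p).
Proof.
split=> [[r0 [M [MSO sub]]]|[r0 [M MSO sub]]]; split => //.
  by exists M => // p pV; apply: sub; exists p.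
by exists M; split => // _ [p pV <-]; exact: sub.
Qed.

Lemma offset_radii_nonempty L L' : is_lattice L -> offset_radii L L' !=set0.
Proof.
move=> /voronoi_bounded[rho rho0 Vrho]; exists rho; apply/offset_radiiP.
split => //; exists 1%:M; first exact: SO1.
move=> p pV; exists 0; first exact: voronoi0.
by rewrite mul1mx edistE subr0 Vrho.
Qed.

Lemma offset_radii_has_lbound L L' : has_lbound (offset_radii L L').
Proof. by exists 0 => r []. Qed.

Lemma lat_offset_le L L' r : offset_radii L L' r -> lat_offset L L' <= r.
Proof. exact: ge_inf (offset_radii_has_lbound L L') _. Qed.

(** Rotations for radii within 1/(k+1) of the infimum cluster at a rotation [M]. For each [p],
    [M *m p] is then in every larger offset, hence in the offset itself by closedness. *)
Lemma lat_offset_attained L L' : is_lattice L -> is_lattice L' ->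
  offset_radii L L' (lat_offset L L').
Proof.
move=> Ll Ll'; set r := lat_offset L L'.
have hi : has_inf (offset_radii L L').
  by split; [exact: offset_radii_nonempty | exact: offset_radii_has_lbound].
apply/offset_radiiP; split; first by apply: lb_le_inf hi.1 _ => s [].
have /choice[u uP] k : exists M, is_SO M /\ forall p, voronoi L p ->
    offset_set (voronoi L') (r + k.+1%:R^-1) (M *m p).
  have k0 : 0 < k.+1%:R^-1 :> R by rewrite invr_gt0.
  have [s /offset_radiiP[_ [M MSO sub]] sr] := inf_adherent k0 hi.
  exists M; split => // p /sub[q qV pq]; exists q => //.
  by apply: le_trans pq _; apply: ltW.
have [|M MSO uM] := @SO_seq_cluster R n u; first by move=> k; have [] := uP k.
exists M => // p pV; apply: offset_voronoi_closed => // e e0.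
have e20 : 0 < e / 2 by lra.
have [m _ me] := near_infty_natSinv_lt (PosNum e20).
(* Half of [e] pays for replacing [u k] by [M] at [p], so the tolerance is scaled by the size of
   [p]; the other half pays for 1/(k+1). *)
have n0 : 0 < n%:R * (n%:R * enorm p) + 1 :> R.
  by rewrite ltr_wpDl // !mulr_ge0 // enorm_ge0.
have [k mk] := uM _ m (divr_gt0 e20 n0).
rewrite ltr_pdivlMr // distrC => ukM.
have [_ /(_ p pV)[q qV pq]] := uP k; exists q => //.
apply: le_trans (edist_rot _ _ _ (u k)) _.
have /= := me k mk; have := normr_ge0 (M - u k).
move: pq ukM; set d := _^-1; lra.
Qed.

Lemma lat_offset_ge0 L L' : is_lattice L -> is_lattice L' -> 0 <= lat_offset L L'.
Proof. by move=> Ll Ll'; have [] := lat_offset_attained Ll Ll'. Qed.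

Lemma lat_offset_triangle L L' L'' :
  is_lattice L -> is_lattice L' -> is_lattice L'' ->
  lat_offset L L'' <= lat_offset L L' + lat_offset L' L''.
Proof.
move=> Ll Ll' Ll''; apply: lat_offset_le; apply/offset_radiiP.
have /offset_radiiP[r0 [M MSO sub]] := lat_offset_attained Ll Ll'.
have /offset_radiiP[r0' [N NSO sub']] := lat_offset_attained Ll' Ll''.
split; first exact: addr_ge0.
exists (N *m M); first exact: SO_mul.
move=> p /sub[q /sub'[q' q'V qq'] pq]; exists q' => //; rewrite -mulmxA.
apply: le_trans (edist_le_trans _ (N *m q) _) _.
by rewrite edist_orthogonal ?lerD //; case: NSO.
Qed.

(** * Nonnegativity, symmetry and triangle inequality *)

Lemma dH_ge0 L L' : is_lattice L -> is_lattice L' -> 0 <= dH L L'.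
Proof. by move=> Ll Ll'; rewrite le_max lat_offset_ge0. Qed.

Lemma dH_sym L L' : dH L L' = dH L' L.
Proof. by rewrite /dH maxC. Qed.

Lemma dH_triangle L L' L'' : is_lattice L -> is_lattice L' -> is_lattice L'' ->
  dH L L'' <= dH L L' + dH L' L''.
Proof.
move=> Ll Ll' Ll''; rewrite /dH ge_max; apply/andP; split.
  apply: le_trans (lat_offset_triangle Ll Ll' Ll'') _.
  by rewrite lerD // le_max lexx.
apply: le_trans (lat_offset_triangle Ll'' Ll' Ll) _.
by rewrite addrC lerD // le_max lexx orbT.
Qed.

End Voronoi.

(** * A Voronoi cell determines its lattice *)

Section VoronoiDeterminesLattice.
Variables (R : realType) (n : nat).
Implicit Types (L : set 'cV[R]_n) (p q v w x d : 'cV[R]_n) (s : seq 'cV[R]_n).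

Definition cut_by s p := forall v, v \in s -> 2 * dot p v <= dot v v.

(** Only one inclusion is recorded; the converse follows since the vectors of [s] lie in [L]. *)
Definition describes s L := (forall v, v \in s -> L v /\ 0 < dot v v) /\
  (forall p, cut_by s p -> voronoi L p).

Lemma dot_gt0 v : v != 0 -> 0 < dot v v.
Proof.
by move=> vN0; rewrite lt_def dot_ge0 andbT; apply: contra_neq vN0; exact: dot_eq0.
Qed.

Lemma voronoi_describable L : is_lattice L -> exists s, describes s L.
Proof.
move=> Ll; have [rho rho0 Vrho] := voronoi_bounded Ll.
have [s0 s0P] := lattice_finite (2 * (rho + 1)) Ll.
pose s := [seq v <- s0 | `[< L v /\ v != 0 >]].
(* Inside the ball of radius [rho + 1], a vector [q] violated at [p] satisfies |q|^2 < 2|p||q|, so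
   it is short enough to be in the list. *)
have near p : enorm p <= rho + 1 -> cut_by s p -> voronoi L p.
  move=> prho ps; apply/voronoiP => q Lq; rewrite leNgt; apply/negP => qp.
  have qN0 : q != 0.
    by apply: contraTneq qp => ->; rewrite dotC !dot0l mulr0 ltxx.
  suff qs : q \in s by have := ps q qs; rewrite leNgt qp.
  rewrite mem_filter; apply/andP; split; first exact/asboolP.
  apply: s0P => //; have := dot_gt0 qN0; rewrite -enorm_sqr => q0.
  have := cauchy_schwarz p q; have := enorm_ge0 q; have := enorm_ge0 p.
  by move: qp; rewrite -enorm_sqr; nra.
exists s; split=> [v|p ps].
  by rewrite mem_filter => /andP[/asboolP[Lv vN0] _]; split; rewrite ?dot_gt0.
(* A point farther out could be scaled to norm [rho + 1] without violating a constraint, giving a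
   point of the cell beyond its radius bound [rho]. *)
have [prho|prho] := leP (enorm p) (rho + 1); first exact: near.
have p0 : 0 < enorm p by lra.
pose t := (rho + 1) / enorm p.
have t0 : 0 <= t by rewrite divr_ge0 ?enorm_ge0 //; lra.
have t1 : t <= 1 by rewrite ler_pdivrMr // mul1r ltW.
have tp : enorm (t *: p) = rho + 1 by rewrite enormZ ger0_norm // divfK ?gt_eqF.
have /Vrho : voronoi L (t *: p).
  apply: near => [|v vs]; first by rewrite tp.
  have := ps v vs; have := dot_ge0 v; rewrite dotZl; nra.
by rewrite tp; lra.
Qed.

(** As long as some constraint follows from the others, its vector is deleted; the length of the
    list decreases. *)
Lemma voronoi_irredundant L : is_lattice L -> exists2 s, describes s L &
  forall v, v \in s ->
    exists2 p, cut_by [seq w <- s | w != v] p & dot v v < 2 * dot p v.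
Proof.
move=> /voronoi_describable[s].
have [k] := ubnP (size s); elim: k s => // k IH s sk [sL sV].
have [irr|/existsNP[v /not_implyP[vs /forall2NP redundant]]] :=
    pselect (forall v, v \in s -> exists2 p,
      cut_by [seq w <- s | w != v] p & dot v v < 2 * dot p v).
  by exists s.
apply: (IH [seq w <- s | w != v]).
  rewrite -ltnS; apply: leq_trans sk.
  rewrite ltnS size_filter -(count_predC (pred1 v)).
  by rewrite -[X in (X < _)%N]add0n ltn_add2r -has_count has_pred1.
split=> [w|p ps]; first by rewrite mem_filter => /andP[_ /sL].
apply: sV => w ws; have [->|wv] := eqVneq w v.
  by have [/(_ ps)|/negP] := redundant p; rewrite // -leNgt.
by apply: ps; rewrite mem_filter wv.
Qed.

Lemma slack_persists s x d : (forall w, w \in s -> 2 * dot x w < dot w w) ->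
  exists2 e, 0 < e & forall e', 0 <= e' <= e -> cut_by s (x + e' *: d).
Proof.
elim: s => [|w s IH] sx; first by exists 1.
have [|e e0 es] := IH; first by move=> v vs; apply: sx; rewrite inE vs orbT.
have wx := sx w (mem_head _ _).
have D0 : 0 < 2 * `|dot d w| + 1 by have := normr_ge0 (dot d w); lra.
(* The slack at [w] divided by its rate of change along [d]; adding 1 keeps the denominator
   positive. *)
pose f := (dot w w - 2 * dot x w) / (2 * `|dot d w| + 1).
have f0 : 0 < f by rewrite divr_gt0 //; lra.
exists (Num.min e f); first by rewrite lt_min e0.
move=> e' /andP[e'0]; rewrite le_min => /andP[e'e].
rewrite ler_pdivlMr // => e'f v; rewrite inE => /predU1P[->|vs]; last first.
  by apply: (es e') => //; rewrite e'0.
rewrite dotDl dotZl; have := ler_wpM2l e'0 (ler_norm (dot d w)); lra.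
Qed.

(* A facet vector v of V(L) has a point x of V(L) at which it is the only tight
   constraint; near x, V(L) is a half-space, so that a vector of L' tight at x
   is parallel to v, hence equal to v. *)
Lemma facet_mem L L' s : is_lattice L' -> voronoi L = voronoi L' ->
  describes s L ->
  forall v p, v \in s -> cut_by [seq w <- s | w != v] p ->
    dot v v < 2 * dot p v -> L' v.
Proof.
move=> Ll' VV [sL sV] v p vs ps pv.
have [s' [sL' sV']] := voronoi_describable Ll'.
have [Lv v0] := sL v vs; have pv0 : 0 < 2 * dot p v by lra.
(* Scaling [p] by [t] puts it on the hyperplane of [v]; since [t < 1], the remaining constraints
   become strict. *)
pose t := dot v v / (2 * dot p v).
have t0 : 0 < t by rewrite divr_gt0.
have t1 : t < 1 by rewrite ltr_pdivrMr // mul1r.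
pose x := t *: p.
have xv : 2 * dot x v = dot v v.
  by rewrite dotZl mulrCA divfK // gt_eqF.
have xw w : w \in [seq w <- s | w != v] -> 2 * dot x w < dot w w.
  move=> ws; have := ps w ws; rewrite dotZl.
  by move: ws; rewrite mem_filter => /andP[_ /sL[_ w0]]; nra.
clearbody x.
have dirV d : dot d v <= 0 -> exists2 e, 0 < e & voronoi L (x + e *: d).
  move=> dv; have [e e0 es] := slack_persists d xw; exists e => //.
  apply: sV => w ws; have [->|wv] := eqVneq w v.
    by rewrite dotDl dotZl; have := mulr_ge0_le0 (ltW e0) dv; lra.
  by apply: (es e) => //; rewrite ?lexx ?(ltW e0) // mem_filter wv.
have xV' : voronoi L' x.
  have [|e _] := dirV 0; first by rewrite dot0l.
  by rewrite scaler0 addr0 VV.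
(* If all constraints in [s'] were slack at [x], a slightly enlarged [x] would stay in the common
   cell, although it violates the constraint of [v]. *)
have [w ws' xw'] : exists2 w, w \in s' & 2 * dot x w = dot w w.
  apply: contrapT => /forall2NP notight.
  have [w ws'|e e0 /(_ e)] := @slack_persists s' x x.
    rewrite lt_neqAle; have /voronoiP/(_ w (sL' w ws').1) -> := xV'.
    by rewrite andbT; apply/eqP; case: (notight w).
  rewrite lexx (ltW e0) => /(_ isT)/sV'; rewrite -VV => /voronoiP/(_ v Lv).
  by rewrite dotDl dotZl; nra.
have [Lw w0] := sL' w ws'.
pose l := dot w v / dot v v.
have lv : l * dot v v = dot w v by rewrite divfK ?gt_eqF.
clearbody l; have dv : dot (w - l *: v) v = 0 by rewrite !dotL lv subrr.
(* Applied to the component of [w] orthogonal to [v], this forces that component to vanish. *)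
have dirw d : dot d v <= 0 -> dot d w <= 0.
  move=> /dirV[e e0]; rewrite VV => /voronoiP/(_ w Lw).
  by rewrite dotDl dotZl -(pmulr_rle0 _ e0); lra.
have dw : dot (w - l *: v) w <= 0 by apply: dirw; rewrite dv.
have /eqP : w - l *: v = 0.
  apply: dot_eq0; apply/eqP; rewrite eq_le dot_ge0 andbT.
  by rewrite dotDr dotNr dotZr dv mulr0 subr0.
rewrite subr_eq0 => /eqP wE; move: xw' w0 Lw; rewrite wE !dotL => xw' w0 Lw.
(* Tightness of both [v] and [l *: v] at [x] gives l = l^2, and [l = 0] is excluded because [w] is
   nonzero. *)
have /eqP : l * (l - 1) * dot v v = 0 by have := congr1 ( *%R l) xv; lra.
rewrite !mulf_eq0 (gt_eqF v0) orbF => /orP[/eqP l0|].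
  by move: w0; rewrite l0; lra.
by rewrite subr_eq0 => /eqP l1; move: Lw; rewrite l1 scale1r.
Qed.

Lemma voronoi_inj_sub L L' : is_lattice L -> is_lattice L' ->
  voronoi L = voronoi L' -> L `<=` L'.
Proof.
move=> Ll Ll' VV; have [s sd irr] := voronoi_irredundant Ll.
have sL' v : v \in s -> L' v.
  move=> vs; have [p ps pv] := irr v vs.
  exact: facet_mem Ll' VV sd v p vs ps pv.
have [sL sV] := sd.
move=> x0 Lx0; have [F FP] := lattice_finite (enorm x0) Ll.
(* Descent measure: the number of entries of the finite list [F] shorter than [x]. *)
pose below x := count (fun y => enorm y < enorm x) F.
suff below_ind k x : (below x < k)%N -> L x -> enorm x <= enorm x0 -> L' x.
  exact: (below_ind (below x0).+1).
elim: k x => // k IH x xk Lx xx0.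
have [->|xN0] := eqVneq x 0; first exact: lattice0.
(* A nonzero lattice vector violates its own constraint, so it is outside the cell and some [v] in
   [s] cuts it off. *)
have [v vs xv] : exists2 v, v \in s & dot v v < 2 * dot x v.
  apply: contrapT => /forall2NP xs.
  have /sV/voronoiP/(_ x Lx) : cut_by s x.
    by move=> v vs; have [//|/negP] := xs v; rewrite -leNgt.
  by have := dot_gt0 xN0; lra.
have Ly : L (x - v) by apply: latticeB => //; exact: (sL v vs).1.
have yx : enorm (x - v) < enorm x.
  rewrite ltr_sqrt ?dot_gt0 // !dotL (dotC v x); lra.
rewrite -(subrK v x); apply: latticeD => //; last exact: sL'.
apply: IH => //; last by apply: le_trans (ltW yx) xx0.
rewrite -ltnS; apply: leq_ltn_trans xk.
have yF : x - v \in F by apply: FP => //; apply: le_trans (ltW yx) xx0.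
(* [x - v] is counted for [x] but not for itself, which makes the measure drop strictly. *)
have dis :
    count (predI (fun y => enorm y < enorm (x - v)) (pred1 (x - v))) F = 0%N.
  apply/eqP; rewrite -leqn0 leqNgt -has_count; apply/hasPn => y _ /=.
  by apply/negP => /andP[yxv /eqP yE]; move: yxv; rewrite yE ltxx.
have := count_predUI (fun y => enorm y < enorm (x - v)) (pred1 (x - v)) F.
rewrite dis addn0 => cU.
have : (0 < count_mem (x - v)%R F)%N by rewrite -has_count has_pred1.
rewrite -(ltn_add2l (below (x - v)%R)) addn0 -cU => /leq_trans; apply.
apply: sub_count => y /= /orP[yxv|/eqP ->] //; exact: lt_trans yxv yx.
Qed.

Lemma voronoi_inj L L' : is_lattice L -> is_lattice L' ->
  voronoi L = voronoi L' -> L = L'.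
Proof. by move=> Ll Ll' VV; apply/seteqP; split; exact: voronoi_inj_sub. Qed.

End VoronoiDeterminesLattice.

(** * Lattices at distance zero *)

Section Equivalence.
Variables (R : realType) (n : nat).
Implicit Types (M N A : 'M[R]_n) (L : set 'cV[R]_n) (p q x : 'cV[R]_n).

(* An isometry of a compact set into itself is onto: the orbit of x under A
   returns arbitrarily close to x. *)
Lemma voronoi_isometry_onto L A : is_lattice L -> A^T *m A = 1%:M ->
  (forall p, voronoi L p -> voronoi L (A *m p)) ->
  forall p, voronoi L p -> voronoi L (A^T *m p).
Proof.
move=> Ll AO AV x xV; pose u k := iter k (mulmx A) x.
have uV k : voronoi L (u k) by elim: k => //= k; exact: AV.
have uD k j : edist (u (k + j)%N) (u k) = edist (u j) x.
  by elim: k => // k IH; rewrite addSn /= edist_orthogonal.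
have [q _ uq] := voronoi_seq_cluster Ll uV.
apply: voronoi_closed => e e0; have e20 : 0 < e / 2 by lra.
have [k _ kq] := uq _ 0%N e20; have [m km mq] := uq _ k.+1 e20.
(* Since [m > k], [u j.+1] is [u (m - k)]; it is as far from [x] as [u m] is from [u k], and [u j]
   is as far from the preimage of [x]. *)
pose j := (m - k.+1)%N; exists (u j); first exact: uV.
rewrite -(edist_orthogonal _ _ AO) mulmxA (mulmx1C AO) mul1mx.
rewrite -[A *m u j]/(u j.+1) -(uD k) addnS -addSn subnKC //.
by apply: le_trans (edist_le_trans _ q _) _; rewrite (edistC q); lra.
Qed.

Lemma offset_set0 L p : offset_set (voronoi L) 0 p -> voronoi L p.
Proof.
move=> [q qV pq]; suff -> : p = q by [].
apply/eqP; rewrite -subr_eq0; apply/eqP/enorm_eq0.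
by apply/eqP; rewrite eq_le enorm_ge0 andbT -edistE.
Qed.

Lemma SO_unitmx M : is_SO M -> M \in unitmx.
Proof. by move=> [_ Md]; rewrite unitmxE Md unitr1. Qed.

Lemma rot_imageK M L : M^T *m M = 1%:M -> rot_image M^T (rot_image M L) = L.
Proof.
move=> MO; apply/seteqP; split => [_ [_ [p Lp <-] <-]|p Lp].
  by rewrite mulmxA MO mul1mx.
by exists (M *m p); [exists p | rewrite mulmxA MO mul1mx].
Qed.

Lemma dH_eq0 L L' : is_lattice L -> is_lattice L' ->
  dH L L' = 0 -> lat_equiv L L'.
Proof.
move=> Ll Ll' d0.
have o0 K K' : is_lattice K -> is_lattice K' -> lat_offset K K' <= dH L L' ->
    exists2 M, is_SO M & forall p, voronoi K p -> voronoi K' (M *m p).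
  move=> Kl Kl'; rewrite d0 => K0.
  have /offset_radiiP[r0 [M MSO MV]] := lat_offset_attained Kl Kl'.
  exists M => // p /MV; suff -> : lat_offset K K' = 0 by exact: offset_set0.
  by apply/eqP; rewrite eq_le K0 r0.
have [|M MSO MV] := o0 L L' Ll Ll'; first by rewrite le_max lexx.
have [|N NSO NV] := o0 L' L Ll' Ll; first by rewrite le_max lexx orbT.
have [NO _] := NSO; have [AO _] := SO_mul NSO MSO.
have VV : voronoi (rot_image N L') = voronoi L.
  rewrite voronoi_rot //; apply/seteqP; split=> [_ [p pV <-]|x xV].
    exact: NV.
  (* [N *m M] maps the cell of [L] into itself, hence so does its transpose, which is its
     inverse. *)
  exists (M *m ((N *m M)^T *m x)).
    apply: (MV); apply: voronoi_isometry_onto => // p pV.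
    by rewrite -mulmxA; apply: NV; apply: MV.
  by rewrite mulmxA mulmxA (mulmx1C AO) mul1mx.
have NL : rot_image N L' = L.
  by apply: voronoi_inj VV => //; apply: lattice_mul => //; exact: SO_unitmx.
exists N^T; split; first exact: SO_tr.
by rewrite -NL rot_imageK.
Qed.

Lemma lat_offset_rot M L L' : is_SO M -> rot_image M L = L' ->
  lat_offset L L' <= 0.
Proof.
move=> MSO <-; apply: lat_offset_le; apply/offset_radiiP; split => //.
exists M => // p pV; exists (M *m p); last by rewrite edistE subrr enorm0.
by rewrite voronoi_rot; [exists p | case: MSO].
Qed.

Lemma lat_equiv_dH0 L L' : is_lattice L -> is_lattice L' ->
  lat_equiv L L' -> dH L L' = 0.
Proof.
move=> Ll Ll' [M [MSO ML]]; apply/eqP; rewrite eq_le dH_ge0 // andbT ge_max.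
rewrite (lat_offset_rot MSO ML) (lat_offset_rot (SO_tr MSO)) //.
by rewrite -ML rot_imageK //; case: MSO.
Qed.

End Equivalence.

(** * Continuity *)

Section Continuity.
Variables (R : realType) (n : nat).
Implicit Types (B T : 'M[R]_n) (L : set 'cV[R]_n) (p q v : 'cV[R]_n).

(* Shrinking by the factor 1 - K eta makes up for moving every lattice vector v
   by at most eta |v|; by separation the resulting error, which is linear in
   |v|, is absorbed by |v|^2. *)
Lemma dH_perturb L T rho c eta : is_lattice L -> T \in unitmx ->
  0 <= rho -> (forall p, exists2 q, L q & enorm (p - q) <= rho) ->
  0 <= c -> (forall q, L q -> enorm q <= c * dot q q) ->
  0 <= eta <= 1 -> (forall v, enorm (T *m v - v) <= eta * enorm v) ->
  (3 + 4 * rho * c) * eta <= 1 ->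
  dH L (rot_image T L) <= 2 * rho * ((3 + 4 * rho * c) * eta).
Proof.
move=> Ll TU rho0 cov c0 sep /andP[eta0 eta1] Teta.
have rc0 : 0 <= rho * c by rewrite mulr_ge0.
(* The 3 accounts for the change of |v|^2 under [T]; 4 [rho] [c] accounts for the change of 2 p.v
   when |p| is at most 2 [rho]. *)
set a := _ * eta => a1; have a0 : 0 <= a by rewrite mulr_ge0 // -mulrA; lra.
pose s := 1 - a; have s0 : 0 <= s by rewrite /s; lra.
have s1 : s <= 1 by rewrite /s; lra.
have bound p e v : enorm p <= e -> L v ->
    `|dot p (T *m v - v)| <= e * c * eta * dot v v.
  move=> pe Lv; have e0 := le_trans (enorm_ge0 _) pe.
  have dT := Teta v; have sv := sep v Lv.
  apply: (@le_trans _ _ (e * (eta * (c * dot v v)))); last by lra.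
  apply: le_trans (norm_dot_le _ _) _; rewrite ler_pM ?enorm_ge0 //.
  by apply: le_trans dT _; rewrite ler_wpM2l.
have Tsq v : `|dot (T *m v) (T *m v) - dot v v| <= 3 * eta * dot v v.
  have -> : dot (T *m v) (T *m v) - dot v v =
      2 * dot v (T *m v - v) + dot (T *m v - v) (T *m v - v).
    by rewrite !dotL (dotC v (T *m v)); ring.
  have dT := Teta v; have v0 := enorm_ge0 v; have d0 := enorm_ge0 (T *m v - v).
  have dd : dot (T *m v - v) (T *m v - v) <= eta * dot v v.
    have := ler_pM d0 d0 dT dT.
    have : eta * eta * enorm v ^+ 2 <= eta * enorm v ^+ 2.
      by rewrite ler_wpM2r ?sqr_ge0 // ler_piMl.
    by rewrite -!enorm_sqr; lra.
  have cs : `|dot v (T *m v - v)| <= eta * dot v v.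
    apply: le_trans (norm_dot_le _ _) _.
    by rewrite -enorm_sqr; have := ler_wpM2l v0 dT; lra.
  have := dot_ge0 (T *m v - v); move: cs; rewrite !ler_norml => /andP[].
  by move=> h1 h2 h3; apply/andP; split; lra.
have VL p : voronoi L p -> voronoi (rot_image T L) (s *: p).
  move=> pV; have prho := voronoi_le_covering cov pV.
  apply/voronoiP => _ [v Lv <-]; have /voronoiP/(_ v Lv) pv := pV.
  have := bound p rho v prho Lv; have := Tsq v.
  rewrite !ler_norml dotZl dotDr dotNr.
  move=> /andP[Tl Tu] /andP[bl bu]; have v0 := dot_ge0 v.
  have h1 : s * (2 * dot p (T *m v)) <= s * ((1 + 2 * rho * c * eta) * dot v v).
    by apply: ler_wpM2l => //; lra.
  have h2 : s * (1 + 2 * rho * c * eta) <= 1 - 3 * eta.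
    have : 0 <= rho * c * eta by rewrite mulr_ge0.
    by rewrite /s /a; nra.
  have := ler_wpM2r v0 h2; lra.
(* The image lattice has covering radius at most (1 + eta) [rho], hence at most 2 [rho]. *)
have VT p : voronoi (rot_image T L) p -> enorm p <= 2 * rho.
  apply: voronoi_le_covering => {}p; have [q Lq pq] := cov (invmx T *m p).
  exists (T *m q); first by exists q.
  rewrite -[X in X - _](mulKVmx TU) -mulmxBr.
  rewrite -(subrK (invmx T *m p - q) (T *m _)).
  apply: le_trans (enormD _ _) _.
  have := Teta (invmx T *m p - q); have := enorm_ge0 (invmx T *m p - q); nra.
have VL' p : voronoi (rot_image T L) p -> voronoi L (s *: p).
  move=> pV; have prho := VT p pV.
  apply/voronoiP => v Lv; have /voronoiP/(_ (T *m v)) pv := pV.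
  have {}pv := pv (ex_intro2 _ _ v Lv erefl).
  have := bound p _ v prho Lv; have := Tsq v.
  rewrite !ler_norml dotZl dotDr dotNr.
  move=> /andP[Tl Tu] /andP[bl bu]; have v0 := dot_ge0 v.
  have h1 : s * (2 * dot p v) <= s * ((1 + a) * dot v v).
    by apply: ler_wpM2l => //; rewrite /a; lra.
  have h2 : s * (1 + a) <= 1 by rewrite /s; nra.
  have := ler_wpM2r v0 h2; lra.
have close p : enorm p <= 2 * rho -> edist (1%:M *m p) (s *: p) <= 2 * rho * a.
  move=> prho; rewrite mul1mx edistE -{1}(scale1r p) -scalerBl enormZ.
  by rewrite /s subKr ger0_norm // mulrC ler_wpM2r.
rewrite ge_max; apply/andP; split; apply: lat_offset_le; apply/offset_radiiP.
  split; first by rewrite mulr_ge0 // mulr_ge0.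
  exists 1%:M; first exact: SO1.
  move=> p pV; exists (s *: p); first exact: VL.
  by apply: close; have := voronoi_le_covering cov pV; lra.
split; first by rewrite mulr_ge0 // mulr_ge0.
exists 1%:M; first exact: SO1.
by move=> p pV; exists (s *: p); [exact: VL' | apply: close; exact: VT].
Qed.

Lemma lattice_ofP B : B \in unitmx -> is_lattice (lattice_of B).
Proof. by exists B. Qed.

Lemma dH_lattice_of_near B0 e : B0 \in unitmx -> 0 < e ->
  exists2 d, 0 < d & forall B, B \in unitmx -> `|B - B0| < d ->
    dH (lattice_of B0) (lattice_of B) <= e.
Proof.
move=> B0U e0; have Ll := lattice_ofP B0U.
have [rho rho0 cov] := lattice_covering Ll.
(* With T = B B0^-1, T v - v = (B - B0) B0^-1 v, so [eta] may be |B - B0| times [D]. The constant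
   [G] makes both K eta <= 1 and 2 rho K eta <= e follow from the bound on |B - B0|. *)
have [c c0 sep] := lattice_separation Ll.
pose K := 3 + 4 * rho * c; have K3 : 3 <= K by rewrite lerDl !mulr_ge0.
pose D := n%:R * (n%:R * (n%:R * `|invmx B0| * n%:R)) : R.
have D0 : 0 <= D by rewrite !mulr_ge0.
pose G := D * (K + 2 * rho * K) + 1.
have rK : 0 <= rho * K by rewrite mulr_ge0 //; lra.
have G0 : 0 < G by rewrite ltr_wpDl // mulr_ge0 //; lra.
exists (Num.min 1 e / G); first by rewrite divr_gt0 // lt_min e0 ltr01.
move=> B BU; rewrite ltr_pdivlMr //; set b := `|B - B0|.
have b0 : 0 <= b by exact: normr_ge0.
rewrite lt_min => /andP[bG1 bGe].
have bD0 : 0 <= b * D by rewrite mulr_ge0.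
have bGE : b * G = K * (b * D) + 2 * rho * (K * (b * D)) + b by rewrite /G; ring.
have KbD : 0 <= K * (b * D) by rewrite mulr_ge0 //; lra.
have rKbD : 0 <= 2 * rho * (K * (b * D)) by rewrite mulr_ge0 // mulr_ge0.
have BE : lattice_of B = rot_image (B *m invmx B0) (lattice_of B0).
  apply/seteqP; split => [_ [z ->]|_ [_ [z ->] <-]]; last first.
    by exists z; rewrite mulmxA mulmxKV.
  by exists (B0 *m map_mx intr z); [exists z | rewrite mulmxA mulmxKV].
rewrite BE; apply: (le_trans (dH_perturb (eta := b * D) Ll _ rho0 cov c0 sep _ _ _)).
- by rewrite unitmx_mul BU unitmx_inv.
- by rewrite bD0 /=; nra.
- move=> v; have -> : B *m invmx B0 *m v - v = (B - B0) *m (invmx B0 *m v).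
    by rewrite mulmxBl !mulmxA mulmxV // mul1mx.
  apply: le_trans (enorm_mulmx _ _) _; rewrite -/b.
  apply: (@le_trans _ _
    (n%:R * b * (n%:R * (n%:R * `|invmx B0| * (n%:R * enorm v))))).
    by rewrite !ler_wpM2l ?mulr_ge0 // enorm_mulmx.
  by rewrite le_eqVlt /D; apply/orP; left; apply/eqP; ring.
- by rewrite -/K; lra.
- by rewrite -/K; lra.
Qed.

(** By the triangle inequality the value changes by at most the sum of the distances moved by the
    two lattices, here at most 2e/3. *)
Lemma dH_lattice_of_continuous :
  {within [set BB : 'M[R]_n * 'M[R]_n | BB.1 \in unitmx /\ BB.2 \in unitmx],
     continuous (fun BB : 'M[R]_n * 'M[R]_n =>
                   dH (lattice_of BB.1) (lattice_of BB.2))}.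
Proof.
apply/subspace_continuousP => -[B0 B0'] /= [B0U B0U'].
apply/cvgrPdist_lt => e e0; have e30 : 0 < e / 3 by lra.
have [d d0 dP] := dH_lattice_of_near B0U e30.
have [d' d0' dP'] := dH_lattice_of_near B0U' e30.
apply/nbhs_ballP; exists (Num.min d d'); first by rewrite /= lt_min d0.
move=> [B B'] /= [B0B B0B'] [BU BU'].
have {B0B}h : dH (lattice_of B0) (lattice_of B) <= e / 3.
  apply: dP => //; move: B0B; rewrite -ball_normE /= distrC.
  by rewrite lt_min => /andP[].
have {B0B'}h' : dH (lattice_of B0') (lattice_of B') <= e / 3.
  apply: dP' => //; move: B0B'; rewrite -ball_normE /= distrC.
  by rewrite lt_min => /andP[].
have Ll := lattice_ofP BU; have Ll' := lattice_ofP BU'.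
have Ll0 := lattice_ofP B0U; have Ll0' := lattice_ofP B0U'.
have := dH_triangle Ll0 Ll Ll0'; have := dH_triangle Ll Ll' Ll0'.
have := dH_triangle Ll Ll0 Ll'; have := dH_triangle Ll0 Ll0' Ll'.
rewrite (dH_sym (lattice_of B') (lattice_of B0')).
rewrite (dH_sym (lattice_of B) (lattice_of B0)) ltr_norml /from_subspace /= => *.
by apply/andP; split; lra.
Qed.

End Continuity.

(** Independence of the representation is built into the types: [dH] is a function of point sets,
    and bases enter only through the existential in [is_lattice] and as the parameters in (d). *)
Theorem theorem2 (R : realType) (n : nat) (hn : (0 < n)%N) :
  (* well-definedness: the min in the definition of offset is attained *)
  (forall L L' : set 'cV[R]_n, is_lattice L -> is_lattice L' ->
     offset_radii L L' (lat_offset L L')) /\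
  (* (a) *)
  (forall L L' : set 'cV[R]_n, is_lattice L -> is_lattice L' ->
     0 <= dH L L' /\ (dH L L' = 0 <-> lat_equiv L L')) /\
  (* (b) *)
  (forall L L' : set 'cV[R]_n, is_lattice L -> is_lattice L' ->
     dH L L' = dH L' L) /\
  (* (c) *)
  (forall L L' L'' : set 'cV[R]_n,
     is_lattice L -> is_lattice L' -> is_lattice L'' ->
     dH L L'' <= dH L L' + dH L' L'') /\
  (* (d) *)
  {within [set BB : 'M[R]_n * 'M[R]_n | BB.1 \in unitmx /\ BB.2 \in unitmx],
     continuous (fun BB : 'M[R]_n * 'M[R]_n =>
                   dH (lattice_of BB.1) (lattice_of BB.2))}.
Proof.
split; first exact: lat_offset_attained.
split.
  move=> L L' Ll Ll'; split; first exact: dH_ge0.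
  by split; [exact: dH_eq0 | exact: lat_equiv_dH0].
split; first by move=> L L' _ _; exact: dH_sym.
by split; [exact: dH_triangle | exact: dH_lattice_of_continuous].
Qed.
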